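(* Let $h:Y\to X$ be a continuous map of topological spaces, let $M\in\mathbb{R}$, and let $f,f':X\to(-\infty,M]$ be (not necessarily continuous) maps. Let $g=fh$ and $g'=f'h$, and let $s>0$. Let $F:(\mathbb{R},\leq)\to\mathbf{Pair}$ be given by $F(c)=(f^{-1}(-\infty,c],\emptyset)$ if $c<M+s$ and $F(c)=(X,f^{-1}[2M+s-c,\infty))$ if $c\geq M+s$, with inclusions as morphisms; define $F'$, $G$ and $G'$ similarly from $f':X\to(-\infty,M]$, $g:Y\to(-\infty,M]$ and $g':Y\to(-\infty,M]$. Then $h$ induces natural transformations $\alpha:G\Rightarrow F$ and $\beta:G'\Rightarrow F'$. Let $\mathbf{A}$ be an abelian category and $H:\mathbf{Pair}\to\mathbf{A}$ a functor. Then $$d(\ker H\alpha,\ker H\beta)\leq\|f-f'\|_\infty,\quad d(\operatorname{im} H\alpha,\operatorname{im} H\beta)\leq\|f-f'\|_\infty,\quad d(\operatorname{coker} H\alpha,\operatorname{coker} H\beta)\leq\|f-f'\|_\infty.$$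
   Context: $(\mathbb{R},\leq)$ denotes the poset of real numbers viewed as a category. $\mathbf{Pair}$ is the category whose objects are pairs $(X,A)$ with $X$ a topological space and $A\subseteq X$ a subspace, and whose morphisms $(X,A)\to(Y,B)$ are continuous maps $u:X\to Y$ with $u(A)\subseteq B$. All subsets carry the subspace topology; $\|\cdot\|_\infty$ is the supremum norm, with values in $[0,\infty]$. The category $\mathbf{A}^{(\mathbb{R},\leq)}$ of functors $(\mathbb{R},\leq)\to\mathbf{A}$ is abelian with objectwise constructions; kernels, images and cokernels of $H\alpha:HG\Rightarrow HF$ and $H\beta:HG'\Rightarrow HF'$ are taken there. For $b\geq 0$, $T_b:(\mathbb{R},\leq)\to(\mathbb{R},\leq)$ is the functor $T_b(a)=a+b$. For $\varepsilon\geq 0$, functors $P,Q:(\mathbb{R},\leq)\to\mathbf{A}$ are $\varepsilon$-interleaved if there are natural transformations $\varphi:P\Rightarrow QT_\varepsilon$ and $\psi:Q\Rightarrow PT_\varepsilon$ such that for all $a\in\mathbb{R}$, $\psi(a+\varepsilon)\varphi(a)=P(a\leq a+2\varepsilon)$ and $\varphi(a+\varepsilon)\psi(a)=Q(a\leq a+2\varepsilon)$. The interleaving distance is $d(P,Q)=\inf\{\varepsilon\geq 0\mid P\text{ and }Q\text{ are }\varepsilon\text{-interleaved}\}$, equal to $\infty$ if there is no such $\varepsilon$. *)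

(* Defs.v *)
From mathcomp Require Import all_boot all_order all_algebra.
From mathcomp Require Import all_classical all_reals topology ereal.

Set Implicit Arguments.
Unset Strict Implicit.
Unset Printing Implicit Defensive.

Import Order.TTheory GRing.Theory Num.Theory.

Local Open Scope classical_set_scope.
Local Open Scope ring_scope.

Record category := Category {
  ob :> Type;
  hom : ob -> ob -> Type;
  idm : forall X, hom X X;
  comp : forall X Y Z, hom Y Z -> hom X Y -> hom X Z;
  comp1m : forall X Y (u : hom X Y), comp (idm Y) u = u;
  compm1 : forall X Y (u : hom X Y), comp u (idm X) = u;
  compA : forall X Y Z W (w : hom Z W) (v : hom Y Z) (u : hom X Y),
    comp w (comp v u) = comp (comp w v) u }.

Arguments hom {c} X Y.
Arguments idm {c} X.
Arguments comp {c X Y Z} v u.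

Declare Scope cat_scope.
Delimit Scope cat_scope with cat.
Notation "v '\c' u" := (comp v u) (at level 40, left associativity) : cat_scope.
Local Open Scope cat_scope.

Record functor (C D : category) := Functor {
  fob :> C -> D;
  fmap : forall X Y, hom X Y -> hom (fob X) (fob Y);
  fmap1 : forall X, fmap (idm X) = idm (fob X);
  fmapM : forall X Y Z (v : hom Y Z) (u : hom X Y),
    fmap (v \c u) = fmap v \c fmap u }.

Arguments fmap {C D} F {X Y} u : rename.

Record nat_trans (C D : category) (F G : functor C D) := NatTrans {
  nt :> forall X : C, hom (F X) (G X);
  ntP : forall (X Y : C) (u : hom X Y), nt Y \c fmap F u = fmap G u \c nt X }.

Lemma nt_ext (C D : category) (F G : functor C D) (a b : nat_trans F G) :
  (forall X, a X = b X) -> a = b.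
Proof.
case: a => a aP; case: b => b bP /= ab.
have e : a = b by exact: functional_extensionality_dep.
by case: _ / e bP => bP; congr NatTrans; exact: Prop_irrelevance.
Qed.

Section functor_category.
Variables C D : category.

Lemma nt_id_subproof (F : functor C D) (X Y : C) (u : hom X Y) :
  idm (F Y) \c fmap F u = fmap F u \c idm (F X).
Proof. by rewrite comp1m compm1. Qed.

Definition nt_id (F : functor C D) : nat_trans F F :=
  NatTrans (@nt_id_subproof F).

Lemma nt_comp_subproof (F G K : functor C D) (b : nat_trans G K)
    (a : nat_trans F G) (X Y : C) (u : hom X Y) :
  (b Y \c a Y) \c fmap F u = fmap K u \c (b X \c a X).
Proof. by rewrite -compA ntP compA ntP compA. Qed.

Definition nt_comp (F G K : functor C D) (b : nat_trans G K)
  (a : nat_trans F G) : nat_trans F K := NatTrans (nt_comp_subproof b a).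

Lemma nt_comp1m (F G : functor C D) (a : nat_trans F G) :
  nt_comp (nt_id G) a = a.
Proof. by apply: nt_ext => X /=; rewrite comp1m. Qed.

Lemma nt_compm1 (F G : functor C D) (a : nat_trans F G) :
  nt_comp a (nt_id F) = a.
Proof. by apply: nt_ext => X /=; rewrite compm1. Qed.

Lemma nt_compA (F G K L : functor C D) (c : nat_trans K L)
    (b : nat_trans G K) (a : nat_trans F G) :
  nt_comp c (nt_comp b a) = nt_comp (nt_comp c b) a.
Proof. by apply: nt_ext => X /=; rewrite compA. Qed.

Definition functor_cat : category := Category nt_comp1m nt_compm1 nt_compA.

End functor_category.

Section functor_composition.
Variables B C D : category.

Lemma fcomp1 (H : functor C D) (F : functor B C) (X : B) :
  fmap H (fmap F (idm X)) = idm (H (F X)).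
Proof. by rewrite !fmap1. Qed.

Lemma fcompM (H : functor C D) (F : functor B C) (X Y Z : B)
    (v : hom Y Z) (u : hom X Y) :
  fmap H (fmap F (v \c u)) = fmap H (fmap F v) \c fmap H (fmap F u).
Proof. by rewrite !fmapM. Qed.

Definition fcomp (H : functor C D) (F : functor B C) : functor B D :=
  Functor (fcomp1 H F) (fcompM H F).

Lemma whisker_subproof (H : functor C D) (F G : functor B C)
    (a : nat_trans F G) (X Y : B) (u : hom X Y) :
  fmap H (a Y) \c fmap H (fmap F u) = fmap H (fmap G u) \c fmap H (a X).
Proof. by rewrite -!fmapM ntP. Qed.

(* Typed as a morphism of the functor category, so that kernels, cokernels and
   images of [whisker H a] are taken there. *)
Definition whisker (H : functor C D) (F G : functor B C) (a : nat_trans F G) :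
    @hom (functor_cat B D) (fcomp H F) (fcomp H G) :=
  @NatTrans B D (fcomp H F) (fcomp H G) (fun X => fmap H (a X))
    (whisker_subproof H a).

End functor_composition.

Record preadditive (A : category) := Preadditive {
  hadd : forall X Y : A, hom X Y -> hom X Y -> hom X Y;
  hopp : forall X Y : A, hom X Y -> hom X Y;
  hzero : forall X Y : A, hom X Y;
  haddA : forall X Y, associative (@hadd X Y);
  haddC : forall X Y, commutative (@hadd X Y);
  hadd0 : forall X Y, left_id (hzero X Y) (@hadd X Y);
  haddN : forall X Y, left_inverse (hzero X Y) (@hopp X Y) (@hadd X Y);
  compDl : forall X Y Z (v v' : hom Y Z) (u : hom X Y),
    hadd v v' \c u = hadd (v \c u) (v' \c u);
  compDr : forall X Y Z (v : hom Y Z) (u u' : hom X Y),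
    v \c hadd u u' = hadd (v \c u) (v \c u') }.

Arguments hadd {A} p {X Y} u v.
Arguments hopp {A} p {X Y} u.
Arguments hzero {A} p X Y.

Section preadditive_notions.
Variables (A : category) (p : preadditive A).

Definition is_zero_object (Z : A) := idm Z = hzero p Z Z.

Definition is_biproduct (X Y P : A) (i1 : hom X P) (i2 : hom Y P)
    (p1 : hom P X) (p2 : hom P Y) :=
  [/\ p1 \c i1 = idm X, p2 \c i2 = idm Y, p1 \c i2 = hzero p Y X,
      p2 \c i1 = hzero p X Y & hadd p (i1 \c p1) (i2 \c p2) = idm P].

Definition is_kernel (X Y : A) (u : hom X Y) (K : A) (k : hom K X) :=
  u \c k = hzero p K Y /\
  forall (Z : A) (z : hom Z X), u \c z = hzero p Z Y ->
    exists! w : hom Z K, k \c w = z.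

Definition is_cokernel (X Y : A) (u : hom X Y) (Q : A) (q : hom Y Q) :=
  q \c u = hzero p X Q /\
  forall (Z : A) (z : hom Y Z), z \c u = hzero p X Z ->
    exists! w : hom Q Z, w \c q = z.

Definition is_iso (X Y : A) (u : hom X Y) :=
  exists v : hom Y X, v \c u = idm X /\ u \c v = idm Y.

End preadditive_notions.

(* Kernels and cokernels are chosen.  The last axiom is Grothendieck's (AB2): the
   canonical morphism from the coimage to the image is an isomorphism; it is the
   unique [w] with [u = kmap (qmap u) \c w \c qmap (kmap u)]. *)
Record abelian_category := AbelianCategory {
  ab_cat :> category;
  ab_pre : preadditive ab_cat;
  ab_zero : exists Z : ab_cat, is_zero_object ab_pre Z;
  ab_biproduct : forall X Y : ab_cat,
    exists P i1 i2 p1 p2, @is_biproduct ab_cat ab_pre X Y P i1 i2 p1 p2;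
  ker : forall X Y : ab_cat, hom X Y -> ab_cat;
  kmap : forall (X Y : ab_cat) (u : hom X Y), hom (ker u) X;
  kerP : forall (X Y : ab_cat) (u : hom X Y), is_kernel ab_pre u (kmap u);
  coker : forall X Y : ab_cat, hom X Y -> ab_cat;
  qmap : forall (X Y : ab_cat) (u : hom X Y), hom Y (coker u);
  cokerP : forall (X Y : ab_cat) (u : hom X Y), is_cokernel ab_pre u (qmap u);
  ab_coim_im : forall (X Y : ab_cat) (u : hom X Y),
    exists2 w : hom (coker (kmap u)) (ker (qmap u)),
      u = kmap (qmap u) \c w \c qmap (kmap u) & is_iso w }.

Arguments ker {a X Y} u.
Arguments kmap {a X Y} u.
Arguments coker {a X Y} u.
Arguments qmap {a X Y} u.

Definition im (A : abelian_category) (X Y : A) (u : hom X Y) : A :=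
  ker (qmap u).

Section abelian_theory.
Variable A : abelian_category.
Local Notation hadd := (hadd (ab_pre A)).
Local Notation hopp := (hopp (ab_pre A)).
Local Notation "0" := (hzero (ab_pre A) _ _).

Lemma haddI (X Y : A) (u v w : hom X Y) : hadd u v = hadd u w -> v = w.
Proof.
move=> /(congr1 (hadd (hopp u))).
by rewrite !haddA !haddN !hadd0.
Qed.

Lemma comp0m (X Y Z : A) (u : hom X Y) : (0 : hom Y Z) \c u = 0.
Proof.
apply: (@haddI _ _ (0 \c u)); rewrite -compDl hadd0.
by rewrite haddC hadd0.
Qed.

Lemma compm0 (X Y Z : A) (v : hom Y Z) : v \c (0 : hom X Y) = 0.
Proof.
apply: (@haddI _ _ (v \c 0)); rewrite -compDr hadd0.
by rewrite haddC hadd0.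
Qed.

Lemma kmap0 (X Y : A) (u : hom X Y) : u \c kmap u = 0.
Proof. by have [] := kerP u. Qed.

Lemma qmap0 (X Y : A) (u : hom X Y) : qmap u \c u = 0.
Proof. by have [] := cokerP u. Qed.

Lemma kmap_inj (X Y Z : A) (u : hom X Y) (w w' : hom Z (ker u)) :
  kmap u \c w = kmap u \c w' -> w = w'.
Proof.
move=> e; have [_ /(_ Z (kmap u \c w))] := kerP u.
rewrite compA kmap0 comp0m => /(_ erefl) [x [_ xu]].
by rewrite -(xu w erefl) (xu w').
Qed.

Lemma qmap_inj (X Y Z : A) (u : hom X Y) (w w' : hom (coker u) Z) :
  w \c qmap u = w' \c qmap u -> w = w'.
Proof.
move=> e; have [_ /(_ Z (w \c qmap u))] := cokerP u.
rewrite -compA qmap0 compm0 => /(_ erefl) [x [_ xu]].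
by rewrite -(xu w erefl) (xu w').
Qed.

Definition klift_sig (X Y Z : A) (u : hom X Y) (z : hom Z X)
  (uz : u \c z = 0) : {w : hom Z (ker u) | kmap u \c w = z}.
Proof.
apply: cid; have [_ /(_ Z z uz) [w [wz _]]] := kerP u.
by exists w.
Qed.

Definition klift (X Y Z : A) (u : hom X Y) (z : hom Z X)
  (uz : u \c z = 0) : hom Z (ker u) := sval (klift_sig uz).

Lemma kliftK (X Y Z : A) (u : hom X Y) (z : hom Z X) (uz : u \c z = 0) :
  kmap u \c klift uz = z.
Proof. exact: svalP (klift_sig uz). Qed.

Definition qdesc_sig (X Y Z : A) (u : hom X Y) (z : hom Y Z)
  (zu : z \c u = 0) : {w : hom (coker u) Z | w \c qmap u = z}.
Proof.
apply: cid; have [_ /(_ Z z zu) [w [wz _]]] := cokerP u.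
by exists w.
Qed.

Definition qdesc (X Y Z : A) (u : hom X Y) (z : hom Y Z)
  (zu : z \c u = 0) : hom (coker u) Z := sval (qdesc_sig zu).

Lemma qdescK (X Y Z : A) (u : hom X Y) (z : hom Y Z) (zu : z \c u = 0) :
  qdesc zu \c qmap u = z.
Proof. exact: svalP (qdesc_sig zu). Qed.

End abelian_theory.

Section functor_abelian.
Variables (C : category) (A : abelian_category).
Local Notation FC := (functor_cat C A).
Local Notation "u +h v" := (hadd (ab_pre A) u v) (at level 50).
Local Notation "0" := (hzero (ab_pre A) _ _).

Section group.
Variables F G : FC.

Lemma nt_add_subproof (a b : hom F G) (X Y : C) (u : hom X Y) :
  (a Y +h b Y) \c fmap F u = fmap G u \c (a X +h b X).
Proof. by rewrite compDl compDr !ntP. Qed.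

Definition nt_add (a b : hom F G) : hom F G := NatTrans (nt_add_subproof a b).

Lemma nt_zero_subproof (X Y : C) (u : hom X Y) :
  (0 : hom (F Y) (G Y)) \c fmap F u = fmap G u \c 0.
Proof. by rewrite comp0m compm0. Qed.

Definition nt_zero : hom F G := NatTrans nt_zero_subproof.

Lemma nt_opp_subproof (a : hom F G) (X Y : C) (u : hom X Y) :
  hopp (ab_pre A) (a Y) \c fmap F u = fmap G u \c hopp (ab_pre A) (a X).
Proof.
apply: (@haddI _ _ _ (a Y \c fmap F u)); rewrite -compDl ntP -compDr.
by rewrite ![a _ +h _]haddC !haddN comp0m compm0.
Qed.

Definition nt_opp (a : hom F G) : hom F G := NatTrans (nt_opp_subproof a).

End group.

Lemma nt_addA F G : associative (@nt_add F G).
Proof. by move=> a b c; apply: nt_ext => X; exact: haddA. Qed.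

Lemma nt_addC F G : commutative (@nt_add F G).
Proof. by move=> a b; apply: nt_ext => X; exact: haddC. Qed.

Lemma nt_add0 F G : left_id (nt_zero F G) (@nt_add F G).
Proof. by move=> a; apply: nt_ext => X; exact: hadd0. Qed.

Lemma nt_addN F G : left_inverse (nt_zero F G) (@nt_opp F G) (@nt_add F G).
Proof. by move=> a; apply: nt_ext => X; exact: haddN. Qed.

Lemma nt_compDl (F G K : FC) (b b' : hom G K) (a : hom F G) :
  nt_add b b' \c a = nt_add (b \c a) (b' \c a).
Proof. by apply: nt_ext => X; exact: compDl. Qed.

Lemma nt_compDr (F G K : FC) (b : hom G K) (a a' : hom F G) :
  b \c nt_add a a' = nt_add (b \c a) (b \c a').
Proof. by apply: nt_ext => X; exact: compDr. Qed.

Definition functor_preadditive : preadditive FC :=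
  Preadditive nt_addA nt_addC nt_add0 nt_addN nt_compDl nt_compDr.

Lemma functor_zero : exists Z : FC, is_zero_object functor_preadditive Z.
Proof.
have [Z Z0] := ab_zero A.
have m (X Y W : C) (v : hom Y W) (u : hom X Y) : idm Z = idm Z \c idm Z.
  by rewrite comp1m.
exists (@Functor C A (fun=> Z) (fun _ _ _ => idm Z) (fun=> erefl) m).
by apply: nt_ext => X.
Qed.

Lemma functor_biproduct (F G : FC) :
  exists P i1 i2 p1 p2, @is_biproduct FC functor_preadditive F G P i1 i2 p1 p2.
Proof.
pose T X := {P : A & (hom (F X) P * hom (G X) P * hom P (F X) * hom P (G X))%type}.
have tex X : exists t : T X, is_biproduct (ab_pre A) (projT2 t).1.1.1
    (projT2 t).1.1.2 (projT2 t).1.2 (projT2 t).2.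
  have [P [i1 [i2 [p1 [p2 bP]]]]] := ab_biproduct (F X) (G X).
  by exists (existT _ P (i1, i2, p1, p2)).
pose P X := projT1 (sval (cid (tex X))).
pose i1 X : hom (F X) (P X) := (projT2 (sval (cid (tex X)))).1.1.1.
pose i2 X : hom (G X) (P X) := (projT2 (sval (cid (tex X)))).1.1.2.
pose p1 X : hom (P X) (F X) := (projT2 (sval (cid (tex X)))).1.2.
pose p2 X : hom (P X) (G X) := (projT2 (sval (cid (tex X)))).2.
have bP X : is_biproduct (ab_pre A) (i1 X) (i2 X) (p1 X) (p2 X).
  exact: svalP (cid (tex X)).
have p11 X : p1 X \c i1 X = idm (F X) by have [] := bP X.
have p22 X : p2 X \c i2 X = idm (G X) by have [] := bP X.
have p12 X : p1 X \c i2 X = 0 by have [] := bP X.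
have p21 X : p2 X \c i1 X = 0 by have [] := bP X.
have pid X : i1 X \c p1 X +h i2 X \c p2 X = idm (P X) by have [] := bP X.
clearbody P i1 i2 p1 p2.
pose m X Y (u : hom X Y) : hom (P X) (P Y) :=
  i1 Y \c fmap F u \c p1 X +h i2 Y \c fmap G u \c p2 X.
have hadd0r (X Y : A) (u : hom X Y) : u +h 0 = u by rewrite haddC hadd0.
have mi1 X Y (u : hom X Y) : m X Y u \c i1 X = i1 Y \c fmap F u.
  by rewrite compDl -!compA p11 p21 !compm0 compm1 hadd0r.
have mi2 X Y (u : hom X Y) : m X Y u \c i2 X = i2 Y \c fmap G u.
  by rewrite compDl -!compA p12 p22 !compm0 compm1 hadd0.
have pm1 X Y (u : hom X Y) : p1 Y \c m X Y u = fmap F u \c p1 X.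
  by rewrite compDr !compA p11 p12 !comp0m comp1m hadd0r.
have pm2 X Y (u : hom X Y) : p2 Y \c m X Y u = fmap G u \c p2 X.
  by rewrite compDr !compA p21 p22 !comp0m comp1m hadd0.
have m1 X : m X X (idm X) = idm (P X) by rewrite /m !fmap1 !compm1.
have mM X Y Z (v : hom Y Z) (u : hom X Y) :
    m X Z (v \c u) = m Y Z v \c m X Y u.
  by rewrite [X in _ = X \c _]/m compDl -!compA pm1 pm2 /m !fmapM !compA.
exists (@Functor C A P m m1 mM).
exists (@NatTrans C A F (@Functor C A P m m1 mM) i1 (fun X Y u => esym (mi1 X Y u))).
exists (@NatTrans C A G (@Functor C A P m m1 mM) i2 (fun X Y u => esym (mi2 X Y u))).
exists (@NatTrans C A (@Functor C A P m m1 mM) F p1 pm1).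
exists (@NatTrans C A (@Functor C A P m m1 mM) G p2 pm2).
by split; apply: nt_ext.
Qed.

Section kernel.
Variables (F G : FC) (a : hom F G).

Lemma nt_ker_subproof (X Y : C) (u : hom X Y) :
  a Y \c (fmap F u \c kmap (a X)) = 0.
Proof. by rewrite compA ntP -compA kmap0 compm0. Qed.

Definition nt_ker_map X Y (u : hom X Y) : hom (ker (a X)) (ker (a Y)) :=
  klift (nt_ker_subproof u).

Lemma nt_ker1 X : nt_ker_map (idm X) = idm _.
Proof. by apply: kmap_inj; rewrite kliftK fmap1 comp1m compm1. Qed.

Lemma nt_kerM X Y Z (v : hom Y Z) (u : hom X Y) :
  nt_ker_map (v \c u) = nt_ker_map v \c nt_ker_map u.
Proof.
by apply: kmap_inj; rewrite compA !kliftK fmapM -!compA kliftK.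
Qed.

Definition nt_ker : FC := Functor nt_ker1 nt_kerM.

Lemma nt_kmap_subproof X Y (u : hom X Y) :
  kmap (a Y) \c fmap nt_ker u = fmap F u \c kmap (a X).
Proof. exact: kliftK. Qed.

Definition nt_kmap : hom nt_ker F :=
  @NatTrans C A nt_ker F (fun X => kmap (a X)) nt_kmap_subproof.

Lemma nt_kerP : is_kernel functor_preadditive a nt_kmap.
Proof.
split; first by apply: nt_ext => X; exact: kmap0.
move=> K z az.
have azX X : a X \c z X = 0 by exact: (congr1 (fun b : nat_trans K G => b X) az).
have nat X Y (u : hom X Y) :
    klift (azX Y) \c fmap K u = fmap nt_ker u \c klift (azX X).
  apply: kmap_inj.
  by rewrite compA kliftK compA nt_kmap_subproof -compA kliftK ntP.
exists (@NatTrans C A K nt_ker (fun X => klift (azX X)) nat).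
split; first by apply: nt_ext => X; exact: kliftK.
move=> w wz; apply: nt_ext => X; apply: kmap_inj; rewrite kliftK.
by rewrite -wz.
Qed.

Lemma nt_coker_subproof (X Y : C) (u : hom X Y) :
  (qmap (a Y) \c fmap G u) \c a X = 0.
Proof. by rewrite -compA -ntP compA qmap0 comp0m. Qed.

Definition nt_coker_map X Y (u : hom X Y) : hom (coker (a X)) (coker (a Y)) :=
  qdesc (nt_coker_subproof u).

Lemma nt_coker1 X : nt_coker_map (idm X) = idm _.
Proof. by apply: qmap_inj; rewrite qdescK fmap1 comp1m compm1. Qed.

Lemma nt_cokerM X Y Z (v : hom Y Z) (u : hom X Y) :
  nt_coker_map (v \c u) = nt_coker_map v \c nt_coker_map u.
Proof.
by apply: qmap_inj; rewrite -compA !qdescK fmapM !compA qdescK.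
Qed.

Definition nt_coker : FC := Functor nt_coker1 nt_cokerM.

Lemma nt_qmap_subproof X Y (u : hom X Y) :
  qmap (a Y) \c fmap G u = fmap nt_coker u \c qmap (a X).
Proof. by rewrite qdescK. Qed.

Definition nt_qmap : hom G nt_coker :=
  @NatTrans C A G nt_coker (fun X => qmap (a X)) nt_qmap_subproof.

Lemma nt_cokerP : is_cokernel functor_preadditive a nt_qmap.
Proof.
split; first by apply: nt_ext => X; exact: qmap0.
move=> K z za.
have zaX X : z X \c a X = 0 by exact: (congr1 (fun b : nat_trans F K => b X) za).
have nat X Y (u : hom X Y) :
    qdesc (zaX Y) \c fmap nt_coker u = fmap K u \c qdesc (zaX X).
  apply: qmap_inj.
  have qE : fmap nt_coker u \c qmap (a X) = qmap (a Y) \c fmap G u.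
    exact/esym/nt_qmap_subproof.
  by rewrite -!compA qE qdescK compA qdescK ntP.
exists (@NatTrans C A nt_coker K (fun X => qdesc (zaX X)) nat).
split; first by apply: nt_ext => X; exact: qdescK.
move=> w wz; apply: nt_ext => X; apply: qmap_inj; rewrite qdescK.
by rewrite -wz.
Qed.

End kernel.

Lemma nt_iso (F G : FC) (w : hom F G) :
  (forall X, is_iso (w X)) -> is_iso w.
Proof.
move=> wi; pose v X := sval (cid (wi X)).
have vw X : v X \c w X = idm (F X) by have [] := svalP (cid (wi X)).
have wv X : w X \c v X = idm (G X) by have [] := svalP (cid (wi X)).
clearbody v.
have nat X Y (u : hom X Y) : v Y \c fmap G u = fmap F u \c v X.
  rewrite -[LHS]compm1 -(wv X) compA -(compA (v Y)) -ntP.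
  by rewrite (compA (v Y)) vw comp1m.
by exists (@NatTrans C A G F v nat); split; apply: nt_ext.
Qed.

Lemma functor_coim_im (F G : FC) (a : hom F G) :
  exists2 w : hom (nt_coker (nt_kmap a)) (nt_ker (nt_qmap a)),
    a = nt_kmap (nt_qmap a) \c w \c nt_qmap (nt_kmap a) & is_iso w.
Proof.
pose w X := s2val (cid2 (ab_coim_im (a X))).
have wE X : a X = kmap (qmap (a X)) \c w X \c qmap (kmap (a X)).
  exact: s2valP (cid2 (ab_coim_im (a X))).
have wi X : is_iso (w X) by exact: s2valP' (cid2 (ab_coim_im (a X))).
clearbody w.
have nat X Y (u : hom X Y) :
    w Y \c fmap (nt_coker (nt_kmap a)) u = fmap (nt_ker (nt_qmap a)) u \c w X.
  apply: kmap_inj; apply: qmap_inj.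
  have qE : fmap (nt_coker (nt_kmap a)) u \c qmap (kmap (a X)) =
      qmap (kmap (a Y)) \c fmap F u by exact/esym/nt_qmap_subproof.
  have kE : kmap (qmap (a Y)) \c fmap (nt_ker (nt_qmap a)) u =
      fmap G u \c kmap (qmap (a X)) by exact: nt_kmap_subproof.
  rewrite -!compA [X in _ \c (_ \c X)]qE [RHS]compA kE !compA.
  rewrite -(compA (fmap G u)) -(compA (fmap G u)).
  transitivity (a Y \c fmap F u); first by congr (_ \c _); exact/esym/wE.
  by rewrite ntP; congr (_ \c _); exact: wE.
exists (@NatTrans C A (nt_coker (nt_kmap a)) (nt_ker (nt_qmap a)) w nat).
  by apply: nt_ext => X; exact: wE.
exact: nt_iso.
Qed.

Definition functor_abelian : abelian_category :=
  AbelianCategory functor_zero functor_biproduct nt_kerP nt_cokerP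
    functor_coim_im.

End functor_abelian.

Canonical functor_abelian.

Section interleaving.
Variable R : realType.

Definition real_cat : category :=
  @Category R (fun a b => (a <= b : Prop)) (@lexx _ R)
    (fun a b c (bc : b <= c) (ab : a <= b) => le_trans ab bc)
    (fun _ _ _ => bool_irrelevance _ _) (fun _ _ _ => bool_irrelevance _ _)
    (fun _ _ _ _ _ _ _ => bool_irrelevance _ _).

Definition translation (b : R) : functor real_cat real_cat :=
  @Functor real_cat real_cat (fun a : R => a + b)
    (fun a a' (aa' : a <= a') => lerD aa' (lexx b))
    (fun _ => bool_irrelevance _ _) (fun _ _ _ _ _ => bool_irrelevance _ _).

(* The target [P (a + 2e)] is written [P ((a + e) + e)]. *)
Definition interleaved (A : category) (e : R) (P Q : functor real_cat A) :=
  exists (phi : nat_trans P (fcomp Q (translation e)))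
         (psi : nat_trans Q (fcomp P (translation e))),
    forall (a : R) (aee : a <= a + e + e),
      psi (a + e) \c phi a = @fmap _ _ P a (a + e + e) aee /\
      phi (a + e) \c psi a = @fmap _ _ Q a (a + e + e) aee.

Definition interleaving_dist (A : category) (P Q : functor real_cat A) : \bar R :=
  ereal_inf [set e%:E | e in [set e : R | 0 <= e /\ interleaved e P Q]].

(* [maxe 0] only matters when [X] is empty: suprema are taken in [0, +oo]. *)
Definition sup_norm (X : Type) (f : X -> R) : \bar R :=
  maxe 0%E (ereal_sup (range (fun x => `|f x|%:E))).

End interleaving.

Record top_pair := Pair { space :> topologicalType; subsp : set space }.

Arguments subsp : clear implicits.

Record pair_hom (P Q : top_pair) := PairHom {
  pfun :> P -> Q;
  pfun_continuous : continuous pfun;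
  pfun_sub : pfun @` subsp P `<=` subsp Q }.

Lemma pair_hom_ext (P Q : top_pair) (u v : pair_hom P Q) : u =1 v -> u = v.
Proof.
case: u => u uc us; case: v => v vc vs /= /funext uv.
by case: _ / uv vc vs => vc vs; congr PairHom; exact: Prop_irrelevance.
Qed.

Lemma pair_id_sub (P : top_pair) : idfun @` subsp P `<=` subsp P.
Proof. by rewrite image_id. Qed.

Lemma pair_id_continuous (P : top_pair) : continuous (@idfun P).
Proof. by move=> x; exact: cvg_id. Qed.

Definition pair_id (P : top_pair) : pair_hom P P :=
  PairHom (@pair_id_continuous P) (@pair_id_sub P).

Lemma pair_comp_continuous (P Q S : top_pair) (v : pair_hom Q S)
  (u : pair_hom P Q) : continuous (v \o u).
Proof. by move=> x; apply: continuous_comp; exact: pfun_continuous. Qed.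

Lemma pair_comp_sub (P Q S : top_pair) (v : pair_hom Q S) (u : pair_hom P Q) :
  (v \o u) @` subsp P `<=` subsp S.
Proof.
move=> _ [x Px <-]; apply: (@pfun_sub _ _ v); exists (u x) => //.
by apply: (@pfun_sub _ _ u); exists x.
Qed.

Definition pair_comp (P Q S : top_pair) (v : pair_hom Q S) (u : pair_hom P Q) :
  pair_hom P S :=
  PairHom (@pair_comp_continuous P Q S v u) (@pair_comp_sub P Q S v u).

Lemma pair_comp1m (P Q : top_pair) (u : pair_hom P Q) :
  pair_comp (pair_id Q) u = u.
Proof. exact: pair_hom_ext. Qed.

Lemma pair_compm1 (P Q : top_pair) (u : pair_hom P Q) :
  pair_comp u (pair_id P) = u.
Proof. exact: pair_hom_ext. Qed.

Lemma pair_compA (P Q S T : top_pair) (w : pair_hom S T) (v : pair_hom Q S)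
    (u : pair_hom P Q) :
  pair_comp w (pair_comp v u) = pair_comp (pair_comp w v) u.
Proof. exact: pair_hom_ext. Qed.

Definition pair_cat : category := Category pair_comp1m pair_compm1 pair_compA.

Section filtration_objects.
Variables (R : realType) (M s : R) (X : topologicalType) (f : X -> R).

Definition filtration_case (c : R) (low : bool) : top_pair :=
  if low then @Pair (set_type (f @^-1` `]-oo, c])) set0
  else @Pair X (f @^-1` `[2 * M + s - c, +oo[).

Definition filtration_ob (c : R) : top_pair := filtration_case c (c < M + s).

Definition case_val (c : R) (low : bool) : filtration_case c low -> X :=
  if low is true then set_val else idfun.

Definition filtration_val (c : R) : filtration_ob c -> X :=
  @case_val c (c < M + s).

Lemma filtration_val_inj c : injective (@filtration_val c).
Proof.
rewrite /filtration_val /filtration_ob.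
by case: (c < M + s) => /=; [exact: val_inj|].
Qed.

Lemma filtration_val_continuous c : continuous (@filtration_val c).
Proof.
rewrite /filtration_val /filtration_ob; case: (c < M + s) => /=.
  exact: initial_continuous.
by move=> x; exact: cvg_id.
Qed.

(* [filtration_ob c] carries the initial topology for [filtration_val]. *)
Lemma filtration_continuous (T : topologicalType) c (k : T -> filtration_ob c) :
  continuous (@filtration_val c \o k) -> continuous k.
Proof.
move: k; rewrite /filtration_val /filtration_ob.
case: (c < M + s) => k //=; exact: continuous_comp_initial.
Qed.

End filtration_objects.

Section filtration_maps.
Variables (R : realType) (M s : R) (X Y : topologicalType).
Variables (g : Y -> R) (f : X -> R) (u : Y -> X) (c c' : R).
Hypotheses (uc : continuous u) (cc' : c <= c')
  (lo : forall y, g y <= c -> f (u y) <= c')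
  (hi : forall y, 2 * M + s - c <= g y -> 2 * M + s - c' <= f (u y)).

Lemma filtration_lift (y : filtration_ob M s g c) :
  exists x : filtration_ob M s f c', filtration_val x = u (filtration_val y).
Proof.
move: y; rewrite /filtration_val /filtration_ob.
case lc : (c < M + s); case lc' : (c' < M + s) => /= y.
- have fy : f (u (val y)) <= c'.
    by apply: lo; have := set_valP y; rewrite /= in_itv.
  have uyP : u (val y) \in f @^-1` `]-oo, c'] by rewrite inE /= in_itv.
  by exists (exist (fun x => x \in _) _ uyP).
- by exists (u (val y)).
- by move: lc; rewrite (le_lt_trans cc' lc').
- by exists (u y).
Qed.

(* The morphism of pairs which is [u] on the underlying points; the lift is
   unique by [filtration_val_inj]. *)
Definition filtration_fun (y : filtration_ob M s g c) : filtration_ob M s f c' :=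
  sval (cid (filtration_lift y)).

Lemma filtration_funE (y : filtration_ob M s g c) :
  filtration_val (filtration_fun y) = u (filtration_val y).
Proof. exact: svalP (cid (filtration_lift y)). Qed.

Lemma filtration_fun_continuous : continuous filtration_fun.
Proof.
apply: filtration_continuous.
have -> : @filtration_val R M s X f c' \o filtration_fun =
    u \o @filtration_val R M s Y g c by apply/funext => y; exact: filtration_funE.
move=> y; apply: continuous_comp; first exact: filtration_val_continuous.
exact: uc.
Qed.

Lemma filtration_fun_sub : filtration_fun @` subsp (filtration_ob M s g c)
  `<=` subsp (filtration_ob M s f c').
Proof.
move=> _ [y yA <-]; move: (filtration_fun y) (filtration_funE y) yA.
move: y; rewrite /filtration_val /filtration_ob.
case lc : (c < M + s); case lc' : (c' < M + s) => //= y x xE yA.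
  by move: lc; rewrite (le_lt_trans cc' lc').
move: yA; rewrite xE.
by rewrite /= !in_itv /= !andbT; exact: hi.
Qed.

Definition filtration_map :
    @hom pair_cat (filtration_ob M s g c) (filtration_ob M s f c') :=
  PairHom filtration_fun_continuous filtration_fun_sub.

End filtration_maps.

Section filtration.
Variables (R : realType) (M s : R) (X : topologicalType) (f : X -> R).

Lemma filtration_lo (c c' : R) (cc' : c <= c') (x : X) :
  f x <= c -> f (idfun x) <= c'.
Proof. by move=> /le_trans; apply. Qed.

Lemma filtration_hi (c c' : R) (cc' : c <= c') (x : X) :
  2 * M + s - c <= f x -> 2 * M + s - c' <= f (idfun x).
Proof. by apply: le_trans; rewrite lerD2l lerN2. Qed.

Definition filtration_incl (c c' : R) (cc' : c <= c') :
    @hom pair_cat (filtration_ob M s f c) (filtration_ob M s f c') :=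
  filtration_map (fun x => cvg_id) cc' (filtration_lo cc') (filtration_hi cc').

Lemma filtration_incl1 c : filtration_incl (lexx c) = idm _.
Proof.
by apply: pair_hom_ext => x; apply: filtration_val_inj; exact: filtration_funE.
Qed.

Lemma filtration_inclM (a b c : R) (bc : b <= c) (ab : a <= b) :
  filtration_incl (le_trans ab bc) = filtration_incl bc \c filtration_incl ab.
Proof.
apply: pair_hom_ext => x; apply: filtration_val_inj.
by rewrite /= !filtration_funE.
Qed.

Definition filtration : functor (real_cat R) pair_cat :=
  @Functor (real_cat R) pair_cat (filtration_ob M s f) filtration_incl
    filtration_incl1 filtration_inclM.

End filtration.

Section induced.
Variables (R : realType) (M s : R) (X Y : topologicalType) (h : Y -> X) (f : X -> R).
Hypothesis hc : continuous h.

Definition filtration_induced_map (c : R) :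
    @hom pair_cat (filtration M s (f \o h) c) (filtration M s f c) :=
  filtration_map (g := f \o h) hc (lexx c) (fun _ => id) (fun _ => id).

Lemma filtration_induced_natural (a b : real_cat R) (ab : hom a b) :
  filtration_induced_map b \c fmap (filtration M s (f \o h)) ab =
  fmap (filtration M s f) ab \c filtration_induced_map a.
Proof.
apply: pair_hom_ext => x; apply: filtration_val_inj.
by rewrite /= !filtration_funE.
Qed.

Definition filtration_induced :
    nat_trans (filtration M s (f \o h)) (filtration M s f) :=
  NatTrans filtration_induced_natural.

End induced.

(* Main.v *)
Require Import Defs.
From mathcomp Require Import all_boot all_order all_algebra.
From mathcomp Require Import all_classical all_reals topology ereal.
From mathcomp Require Import lra.
(* Restores the categorical meaning of names such as hom, comp and fmap. *)
Import Defs.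

(** If |f - f'| <= e everywhere, then f x <= c implies f' x <= c + e, and
    2M + s - c <= f x implies 2M + s - (c + e) <= f' x. So the identity of X
    maps each stage F(c) into F'(c + e), the relative part included, and
    symmetrically F'(c) into F(c + e). Both composites are again the identity
    on points, that is the inclusion F(c) -> F(c + 2e), so F and F' are
    e-interleaved. The same bound holds for f h and f' h, so G and G' are
    e-interleaved by identities of Y, and these two interleavings commute with
    alpha and beta because both sides of each square are h on points.

    Hence alpha and beta are e-interleaved as arrows: an interleaving of
    sources and one of targets that form commutative squares
    ([arrow_interleaved]). Any functor H preserves this
    ([arrow_interleaved_whisker]). In an abelian category such squares induce
    maps on kernels and on cokernels, and uniqueness in the universal
    properties transfers the interleaving equations
    ([ker_interleaved], [coker_interleaved]). For images, one observes that
    the squares from the target to the cokernel make the two cokernel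
    projections e-interleaved arrows ([qmap_arrow_interleaved]), and the image
    is the kernel of that projection.

    Finally e can be the supremum norm itself when that is finite, and there is
    nothing to prove when it is infinite. *)

Import Order.TTheory GRing.Theory Num.Theory.

Local Open Scope classical_set_scope.
Local Open Scope ring_scope.
Local Open Scope cat_scope.

Set Implicit Arguments.
Unset Strict Implicit.

Definition interleaving_pair (R : realType) (A : category) (e : R)
    (P Q : functor (real_cat R) A)
    (phi : nat_trans P (fcomp Q (translation e)))
    (psi : nat_trans Q (fcomp P (translation e))) :=
  forall (a : R) (aee : a <= a + e + e),
    psi (a + e) \c phi a = @fmap _ _ P a (a + e + e) aee /\
    phi (a + e) \c psi a = @fmap _ _ Q a (a + e + e) aee.

(** This is e-interleaving in the category of arrows of [A]: a persistent arrow
    is a natural transformation, and a morphism between two of them is a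
    commutative square. *)
Definition arrow_interleaved (R : realType) (A : category) (e : R)
    (G F G' F' : functor (real_cat R) A)
    (a : nat_trans G F) (b : nat_trans G' F') :=
  exists (phiG : nat_trans G (fcomp G' (translation e)))
         (psiG : nat_trans G' (fcomp G (translation e)))
         (phiF : nat_trans F (fcomp F' (translation e)))
         (psiF : nat_trans F' (fcomp F (translation e))),
    [/\ interleaving_pair phiG psiG, interleaving_pair phiF psiF,
        forall c : R, b (c + e) \c phiG c = phiF c \c a c &
        forall c : R, a (c + e) \c psiG c = psiF c \c b c].

(** The functors H (Q T_e) and (H Q) T_e have the same values but not the same
    functoriality proofs, so the components have to be repackaged. *)
Definition whisker_translation (R : realType) (C D : category) (e : R)
    (H : functor C D) (P Q : functor (real_cat R) C)
    (p : nat_trans P (fcomp Q (translation e))) :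
    nat_trans (fcomp H P) (fcomp (fcomp H Q) (translation e)) :=
  @NatTrans _ _ (fcomp H P) (fcomp (fcomp H Q) (translation e))
    (fun c => fmap H (p c)) (whisker_subproof H p).

Lemma arrow_interleaved_whisker (R : realType) (C D : category) (e : R)
    (H : functor C D) (G F G' F' : functor (real_cat R) C)
    (a : nat_trans G F) (b : nat_trans G' F') :
  arrow_interleaved e a b -> arrow_interleaved e (whisker H a) (whisker H b).
Proof.
move=> [phiG [psiG [phiF [psiF [iG iF ab ba]]]]].
exists (whisker_translation H phiG), (whisker_translation H psiG).
exists (whisker_translation H phiF), (whisker_translation H psiF).
split=> [c cee|c cee|c|c] /=; rewrite -!fmapM; last 2 first.
- by rewrite ab.
- by rewrite ba.
- by have [-> ->] := iG c cee.
- by have [-> ->] := iF c cee.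
Qed.

Section kernels_and_cokernels.
Variables (R : realType) (A : abelian_category) (e : R).
Local Notation RA := (functor_cat (real_cat R) A).
Local Notation zero := (hzero (ab_pre A) _ _).

Section induced_transformations.
Variables (G F G' F' : RA) (a : hom G F) (b : hom G' F').
Variables (u : nat_trans G (fcomp G' (translation e))).
Variables (v : nat_trans F (fcomp F' (translation e))).
Hypothesis sq : forall c : R, b (c + e) \c u c = v c \c a c.

Lemma ker_square_zero (c : R) : b (c + e) \c (u c \c kmap (a c)) = zero.
Proof. by rewrite compA sq -compA kmap0 compm0. Qed.

Lemma ker_square_natural (c d : real_cat R) (cd : hom c d) :
  klift (ker_square_zero d) \c fmap (nt_ker a) cd =
  fmap (fcomp (nt_ker b) (translation e)) cd \c klift (ker_square_zero c).
Proof.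
apply: kmap_inj; rewrite /= /nt_ker_map !compA !kliftK -!compA !kliftK.
by rewrite !compA; congr (_ \c _); exact: (ntP u cd).
Qed.

Definition ker_square : nat_trans (nt_ker a) (fcomp (nt_ker b) (translation e)) :=
  @NatTrans _ _ (nt_ker a) (fcomp (nt_ker b) (translation e))
    (fun c => klift (ker_square_zero c)) ker_square_natural.

Lemma coker_square_zero (c : R) : (qmap (b (c + e)) \c v c) \c a c = zero.
Proof. by rewrite -compA -sq compA qmap0 comp0m. Qed.

Lemma coker_square_natural (c d : real_cat R) (cd : hom c d) :
  qdesc (coker_square_zero d) \c fmap (nt_coker a) cd =
  fmap (fcomp (nt_coker b) (translation e)) cd \c qdesc (coker_square_zero c).
Proof.
apply: qmap_inj; rewrite /= /nt_coker_map -!compA !qdescK !compA !qdescK.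
by rewrite -!compA; congr (_ \c _); exact: (ntP v cd).
Qed.

Definition coker_square :
    nat_trans (nt_coker a) (fcomp (nt_coker b) (translation e)) :=
  @NatTrans _ _ (nt_coker a) (fcomp (nt_coker b) (translation e))
    (fun c => qdesc (coker_square_zero c)) coker_square_natural.

End induced_transformations.

Variables (G F G' F' : RA) (a : hom G F) (b : hom G' F').

(** Post-composition with the monomorphisms [kmap] turns the equations to be
    proved into those of the interleaving of the sources. *)
Lemma ker_interleaved : arrow_interleaved e a b -> interleaved e (ker a) (ker b).
Proof.
move=> [phiG [psiG [phiF [psiF [iG _ ab ba]]]]].
exists (ker_square ab), (ker_square ba) => c cee.
have [pq qp] := iG c cee.
split; apply: kmap_inj; rewrite /= compA !kliftK -compA kliftK compA.
  by rewrite pq.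
by rewrite qp.
Qed.

(** Dually, cokernels inherit the interleaving of the targets because [qmap] is
    epic. Keeping [qmap] in the conclusion, and not only its target, is what
    lets images be treated as kernels. *)
Lemma qmap_arrow_interleaved :
  arrow_interleaved e a b -> arrow_interleaved e (qmap a) (qmap b).
Proof.
move=> [phiG [psiG [phiF [psiF [_ iF ab ba]]]]].
exists phiF, psiF, (coker_square ab), (coker_square ba).
split=> // [c cee|c|c]; [|by rewrite /= qdescK..].
have [pq qp] := iF c cee.
split; apply: qmap_inj; rewrite /= -compA !qdescK compA qdescK -compA.
  by rewrite pq.
by rewrite qp.
Qed.

Lemma coker_interleaved :
  arrow_interleaved e a b -> interleaved e (coker a) (coker b).
Proof.
by move=> /qmap_arrow_interleaved [_ [_ [phi [psi [_ i _ _]]]]]; exists phi, psi.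
Qed.

End kernels_and_cokernels.

Lemma im_interleaved (R : realType) (A : abelian_category) (e : R)
    (G F G' F' : functor_cat (real_cat R) A) (a : hom G F) (b : hom G' F') :
  arrow_interleaved e a b -> interleaved e (im a) (im b).
Proof. by move=> /qmap_arrow_interleaved /ker_interleaved. Qed.

Section filtration_shift.
Variables (R : realType) (M s e : R).
Hypothesis e_ge0 : 0 <= e.

Section shift.
Variables (X : topologicalType) (f f' : X -> R).
Hypothesis ff' : forall x, `|f x - f' x| <= e.

Lemma shift_le (c : R) : c <= c + e.
Proof. by rewrite lerDl. Qed.

Lemma shift_lo (c : R) (x : X) : f x <= c -> f' (idfun x) <= c + e.
Proof. by move=> fc; have := ff' x; rewrite ler_norml => /andP[]; lra. Qed.

Lemma shift_hi (c : R) (x : X) :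
  2 * M + s - c <= f x -> 2 * M + s - (c + e) <= f' (idfun x).
Proof. by move=> fc; have := ff' x; rewrite ler_norml => /andP[]; lra. Qed.

Definition shift_map (c : R) :
    @hom pair_cat (filtration M s f c) (filtration M s f' (c + e)) :=
  filtration_map (fun x => cvg_id) (shift_le c) (@shift_lo c) (@shift_hi c).

Lemma shift_natural (c d : real_cat R) (cd : hom c d) :
  shift_map d \c fmap (filtration M s f) cd =
  fmap (fcomp (filtration M s f') (translation e)) cd \c shift_map c.
Proof.
apply: pair_hom_ext => x; apply: filtration_val_inj.
by rewrite /= !filtration_funE.
Qed.

Definition shift :
    nat_trans (filtration M s f) (fcomp (filtration M s f') (translation e)) :=
  @NatTrans _ _ (filtration M s f)
    (fcomp (filtration M s f') (translation e)) shift_map shift_natural.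

End shift.

(** All maps involved are determined by what they do to the points of [X] or
    [Y], and there every equation is between composites of [h] and identities. *)
Lemma filtration_arrow_interleaved (X Y : topologicalType) (h : Y -> X)
    (hc : continuous h) (f f' : X -> R) (ff' : forall x, `|f x - f' x| <= e) :
  arrow_interleaved e (filtration_induced M s f hc)
    (filtration_induced M s f' hc).
Proof.
have f'f x : `|f' x - f x| <= e by rewrite distrC.
exists (@shift Y (f \o h) (f' \o h) (fun y => ff' (h y))).
exists (@shift Y (f' \o h) (f \o h) (fun y => f'f (h y))).
exists (shift ff'), (shift f'f).
split=> [c cee|c cee|c|c]; try split.
all: apply: pair_hom_ext => x; apply: filtration_val_inj.
all: by rewrite /= !filtration_funE.
Qed.

End filtration_shift.

Lemma interleaving_dist_le_sup_norm (R : realType) (A : category)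
    (X : Type) (f f' : X -> R) (P Q : functor (real_cat R) A) :
  (forall e : R, 0 <= e -> (forall x, `|f x - f' x| <= e) ->
    interleaved e P Q) ->
  (interleaving_dist P Q <= sup_norm (f \- f')%R)%E.
Proof.
move=> PQ.
have n_ge0 : (0 <= sup_norm (f \- f')%R)%E by rewrite le_max lexx.
have n_ge x : (`|f x - f' x|%:E <= sup_norm (f \- f')%R)%E.
  by rewrite le_max; apply/orP; right; apply: ereal_sup_ubound; exists x.
move: n_ge0 n_ge; case: (sup_norm _) => [e|_ _|]; last by [].
(* [e] is the norm itself, hence an admissible interleaving parameter. *)
- rewrite lee_fin => e_ge0 fe; apply: ereal_inf_lbound.
  by exists e => //; split=> //; apply: PQ => // x; rewrite -lee_fin.
- exact: leey.
Qed.

Unset Implicit Arguments.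

Theorem theorem7p14 (R : realType) (X Y : topologicalType) (h : Y -> X)
  (hc : continuous h) (M : R) (f f' : X -> R)
  (fM : forall x : X, f x <= M) (f'M : forall x : X, f' x <= M)
  (s : R) (s_gt0 : 0 < s)
  (A : abelian_category) (H : functor pair_cat A) :
  let F := filtration M s f in
  let F' := filtration M s f' in
  let G := filtration M s (f \o h) in
  let G' := filtration M s (f' \o h) in
  let alpha : nat_trans G F := filtration_induced M s f hc in
  let beta : nat_trans G' F' := filtration_induced M s f' hc in
  let Halpha := whisker H alpha in
  let Hbeta := whisker H beta in
  [/\ (interleaving_dist (ker Halpha) (ker Hbeta) <= sup_norm (f \- f')%R)%E,
      (interleaving_dist (im Halpha) (im Hbeta) <= sup_norm (f \- f')%R)%E &
      (interleaving_dist (coker Halpha) (coker Hbeta)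
         <= sup_norm (f \- f')%R)%E].
Proof.
move=> F F' G G' alpha beta Halpha Hbeta.
have HI (e : R) (e_ge0 : 0 <= e) (ff' : forall x, `|f x - f' x| <= e) :
    arrow_interleaved e Halpha Hbeta.
  by apply: arrow_interleaved_whisker; exact: filtration_arrow_interleaved.
split; apply: interleaving_dist_le_sup_norm => e e_ge0 ff'.
- exact: ker_interleaved (HI e e_ge0 ff').
- exact: im_interleaved (HI e e_ge0 ff').
- exact: coker_interleaved (HI e e_ge0 ff').
Qed.
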